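(* Let $r\ge1$ be an integer, $V=\mathbb{F}_2^r$, $\chi$ a non-degenerate symmetric bicharacter of $V$, and $\tau$ a square root of $|V|^{-1}$. Let $k\ge1$ be an integer. The $2k$-th Frobenius-Schur indicator of $m\in\mathcal{TY}(V,\chi,\tau)$ (with its canonical pivotal structure) is given as follows: (a) If $\chi$ is isometric to $\chi_{\rm sym}$, $$\nu_{2k}(m)=\mathrm{sgn}(\tau)^k\left(\frac{1+\sqrt{-1}}{\sqrt2}\right)^{rk}\left(\frac{1+(\sqrt{-1})^{-k}}{\sqrt2}\right)^r.$$ (b) If $r$ is even and $\chi$ is isometric to $\chi_{\rm alt}$, $$\nu_{2k}(m)=\begin{cases}\mathrm{sgn}(\tau)&\text{if }k\text{ is odd},\\2^{\frac12r}&\text{if }k\text{ is even}.\end{cases}$$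
   Context: For a bilinear form $B$ on $V=\mathbb{F}_2^r$ let $\chi_B(v,w)=(-1)^{B(v,w)}$. $\chi_{\rm sym}=\chi_{B}$ for the bilinear form determined by $B(e_i,e_j)=\delta_{ij}$ on the standard basis; for $r$ even, $\chi_{\rm alt}=\chi_B$ for $B(i_1,\dots,i_r;j_1,\dots,j_r)=\sum_{s=1}^{r/2}(i_{2s-1}j_{2s}+i_{2s}j_{2s-1})$. Two symmetric bicharacters $\chi_1,\chi_2$ of $V$ are isometric if there is a group automorphism $f$ of $V$ with $\chi_2(f(v),f(w))=\chi_1(v,w)$ for all $v,w$. Everything is over $\mathbb{C}$. A bicharacter of a finite abelian group $A$ (written multiplicatively below) is a map $\chi: A\times A\to\mathbb{C}^\times$ multiplicative in each variable; it is symmetric if $\chi(a,b)=\chi(b,a)$, and non-degenerate if $\chi(x,a)=1$ for all $x\in A$ implies $a=1$. Tambara-Yamagami category. $\mathcal{TY}(A,\chi,\tau)$ (with $\tau\in\mathbb{R}$, $\tau^2=|A|^{-1}$) is the skeletal $\mathbb{C}$-linear monoidal category whose objects are finite direct sums of elements of $S=A\sqcup\{m\}$, with $\mathrm{Hom}(s,s')=\mathbb{C}$ if $s=s'$ and $0$ otherwise ($s,s'\in S$) and the obvious composition. The tensor product is $a\otimes b=ab$, $a\otimes m=m=m\otimes a$, $m\otimes m=\bigoplus_{x\in A}x$ ($a,b\in A$). The unit object is $1\in A$ with identity unit constraints. The associativity constraint $\Phi_{X,Y,Z}:(X\otimes Y)\otimes Z\to X\otimes(Y\otimes Z)$ is determined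 by $\Phi_{a,m,b}=\chi(a,b)\,\mathrm{id}_m$, $\Phi_{m,a,m}=(\chi(a,x)\delta_{x,y}\mathrm{id}_x)_{x,y}:\bigoplus_x x\to\bigoplus_y y$, $\Phi_{m,m,m}=(\tau\chi(x,y)^{-1}\mathrm{id}_m)_{x,y}:\bigoplus_{x\in A}m\to\bigoplus_{y\in A}m$, all other $\Phi_{s,t,u}$ ($s,t,u\in S$) being identities. The left dual of $a\in A$ is $a^{-1}$ with identity coevaluation and evaluation; the left dual of $m$ is $m$ with coevaluation the injection $1\to m\otimes m$ and evaluation $\tau^{-1}p$, where $p:m\otimes m\to1$ is the projection. The bidual functor is the identity, and the canonical pivotal structure is $j_a=\mathrm{id}_a$ ($a\in A$), $j_m=\mathrm{sgn}(\tau)\,\mathrm{id}_m$. Frobenius-Schur indicators. Let $\mathcal{C}$ be a $\mathbb{C}$-linear rigid monoidal category with pivotal structure $j:\mathrm{id}\to(-)^{**}$, coevaluations $d_X:1\to X\otimes X^*$ and evaluations $b_X:X^*\otimes X\to 1$. Put $X^{\otimes0}=1$, $X^{\otimes 1}=X$, $X^{\otimes n}=X\otimes X^{\otimes(n-1)}$ for $n\ge2$. Let $A^W_{Y,Z}:\mathrm{Hom}(W,Y\otimes Z)\to\mathrm{Hom}(Y^*\otimes W,Z)$ and $B^{W,Y}_Z:\mathrm{Hom}(W\otimes Y,Z)\to\mathrm{Hom}(W,Z\otimes Y^* )$ be the standard duality isomorphisms (up to associativity, $f\mapsto(b_Y\otimes\mathrm{id}_Z)(\mathrm{id}_{Y^*}\otimes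 f)$ and $g\mapsto(g\otimes\mathrm{id}_{Y^*})(\mathrm{id}_W\otimes d_Y)$). Define the linear automorphism $E_X^{(n)}$ of $\mathrm{Hom}(1,X^{\otimes n})$ by $E_X^{(n)}(f)=\Phi\circ(\mathrm{id}_{X^{\otimes(n-1)}}\otimes j_X^{-1})\circ B^{1,X^*}_{X^{\otimes(n-1)}}(A^1_{X,X^{\otimes(n-1)}}(f))$, where $\Phi:X^{\otimes(n-1)}\otimes X\to X^{\otimes n}$ is the associativity isomorphism. The $n$-th Frobenius-Schur indicator is $\nu_n(X)=\mathrm{Tr}(E_X^{(n)})$. *)

(* Defs.v *)
From mathcomp Require Import all_boot all_order all_algebra.
From mathcomp Require Import boolp classical_sets reals.
From mathcomp Require Import complex.

Set Implicit Arguments.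
Unset Strict Implicit.
Unset Printing Implicit Defensive.

Import Order.TTheory GRing.Theory Num.Theory.
Local Open Scope ring_scope.

(** * Pivotal categories and Frobenius-Schur indicators *)

(* The data of a K-linear rigid monoidal category with a pivotal structure.
   Indicators are defined from this data alone, so the coherence laws are not
   recorded here.  [pv_comp g f] is [g] after [f]. *)
Record pivotalData (K : fieldType) := PivotalData {
  pv_ob :> Type;
  pv_hom : pv_ob -> pv_ob -> vectType K;
  pv_id : forall X, pv_hom X X;
  pv_comp : forall X Y Z, pv_hom Y Z -> pv_hom X Y -> pv_hom X Z;
  pv_tens : pv_ob -> pv_ob -> pv_ob;
  pv_tensh : forall X X' Y Y',
    pv_hom X X' -> pv_hom Y Y' -> pv_hom (pv_tens X Y) (pv_tens X' Y');
  pv_one : pv_ob;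
  pv_assoc : forall X Y Z,
    pv_hom (pv_tens (pv_tens X Y) Z) (pv_tens X (pv_tens Y Z));
  pv_lunit : forall X, pv_hom (pv_tens pv_one X) X;
  pv_runit : forall X, pv_hom (pv_tens X pv_one) X;
  pv_dual : pv_ob -> pv_ob;
  pv_coev : forall X, pv_hom pv_one (pv_tens X (pv_dual X));
  pv_ev : forall X, pv_hom (pv_tens (pv_dual X) X) pv_one;
  pv_piv : forall X, pv_hom X (pv_dual (pv_dual X))
}.

Arguments pv_id {K C} X : rename.
Arguments pv_comp {K C X Y Z} g f : rename.
Arguments pv_tens {K C} X Y : rename.
Arguments pv_tensh {K C X X' Y Y'} f g : rename.
Arguments pv_one {K C} : rename.
Arguments pv_assoc {K C} X Y Z : rename.
Arguments pv_lunit {K C} X : rename.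
Arguments pv_runit {K C} X : rename.
Arguments pv_dual {K C} X : rename.
Arguments pv_coev {K C} X : rename.
Arguments pv_ev {K C} X : rename.
Arguments pv_piv {K C} X : rename.

Section Indicator.
Variables (K : fieldType) (C : pivotalData K).

Local Notation "X ⊗ Y" := (pv_tens X Y) (at level 40, left associativity).
Local Notation "f ⊠ g" := (pv_tensh f g) (at level 40, left associativity).
Local Notation "g ∘ f" := (pv_comp g f) (at level 50, left associativity).

(* The inverse of an isomorphism [f]; [0] if [f] is not invertible. *)
Definition pv_inv (X Y : C) (f : pv_hom X Y) : pv_hom Y X :=
  xget 0 [set g | g ∘ f = pv_id X /\ f ∘ g = pv_id Y]%classic.

Fixpoint pv_pow (X : C) (n : nat) : C :=
  match n with
  | 0 => pv_one
  | 1 => X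
  | n'.+1 => X ⊗ pv_pow X n'
  end.

Definition dualA (W Y Z : C) (f : pv_hom W (Y ⊗ Z)) :
    pv_hom (pv_dual Y ⊗ W) Z :=
  pv_lunit Z ∘ (pv_ev Y ⊠ pv_id Z) ∘ pv_inv (pv_assoc (pv_dual Y) Y Z)
    ∘ (pv_id (pv_dual Y) ⊠ f).

Definition dualB (W Y Z : C) (g : pv_hom (W ⊗ Y) Z) :
    pv_hom W (Z ⊗ pv_dual Y) :=
  (g ⊠ pv_id (pv_dual Y)) ∘ pv_inv (pv_assoc W Y (pv_dual Y))
    ∘ (pv_id W ⊠ pv_coev Y) ∘ pv_inv (pv_runit W).

(* The canonical isomorphism from [X^n ⊗ X] to [X^(n+1)]. *)
Fixpoint pow_snoc (X : C) (n : nat) :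
    pv_hom (pv_pow X n ⊗ X) (pv_pow X n.+1) :=
  match n with
  | 0 => pv_lunit X
  | n'.+1 =>
      (if n' is n''.+1 as n0 return
         pv_hom (pv_pow X n0 ⊗ X) (pv_pow X n0.+1) ->
         pv_hom (pv_pow X n0.+1 ⊗ X) (pv_pow X n0.+2)
       then fun h => (pv_id X ⊠ h) ∘ pv_assoc X (pv_pow X n''.+1) X
       else fun=> pv_id (X ⊗ X)) (pow_snoc X n')
  end.

(* The canonical isomorphism from [X^(n+1)] to [X ⊗ X^n]; these objects are
   equal unless [n = 0]. *)
Definition pow_uncons (X : C) (n : nat) :
    pv_hom (pv_pow X n.+1) (X ⊗ pv_pow X n) :=
  match n with
  | 0 => pv_inv (pv_runit X)
  | n'.+1 => pv_id (X ⊗ pv_pow X n'.+1)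
  end.

(* The operator [E_X^(n+1)].  [dualA] produces a map out of [X^* ⊗ 1] and
   [dualB] expects one out of [1 ⊗ X^*]: unit constraints mediate. *)
Definition FSoperator (X : C) (n : nat) (f : pv_hom pv_one (pv_pow X n.+1)) :
    pv_hom pv_one (pv_pow X n.+1) :=
  let g := dualA (pow_uncons X n ∘ f) in
  let h := dualB (g ∘ pv_inv (pv_runit (pv_dual X)) ∘ pv_lunit (pv_dual X)) in
  pow_snoc X n ∘ (pv_id (pv_pow X n) ⊠ pv_inv (pv_piv X)) ∘ h.

(* The trace of [f], assumed to be linear. *)
Definition lin_trace (U : vectType K) (f : U -> U) : K :=
  let e := vbasis {:U} in \sum_(i < \dim {:U}) coord e i (f e`_i).

(* The indicator is only meaningful for [n >= 1]. *)
Definition FSindicator (n : nat) (X : C) : K :=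
  if n is n'.+1 then lin_trace (@FSoperator X n') else 0.

End Indicator.

(** * Bicharacters *)

Section Bicharacters.
Variables (R : realType) (A : finZmodType).
Implicit Types chi : A -> A -> R[i].

Definition bicharacter chi :=
  [/\ forall a b, chi a b != 0,
      forall a b c, chi (a + b) c = chi a c * chi b c
    & forall a b c, chi a (b + c) = chi a b * chi a c].

Definition symmetric_bichar chi := forall a b, chi a b = chi b a.

Definition nondegenerate_bichar chi :=
  forall a, (forall x, chi x a = 1) -> a = 0.

Definition isometric_bichar chi1 chi2 :=
  exists f : {additive A -> A},
    bijective f /\ forall v w, chi2 (f v) (f w) = chi1 v w.

End Bicharacters.

Section StandardBicharacters.
Variables (R : realType) (r : nat).
Local Notation V := 'rV['F_2]_r.

Definition chi_of_form (B : V -> V -> 'F_2) (v w : V) : R[i] :=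
  (-1) ^+ (B v w : nat).

Definition form_sym (v w : V) : 'F_2 := \sum_(i < r) v 0 i * w 0 i.

(* The [n]-th coordinate of [v], counted from 0. *)
Definition crd (v : V) (n : nat) : 'F_2 :=
  if insub n is Some i then v 0 i else 0.

(* Coordinates are counted from 0, so the pair (2s-1, 2s) becomes (2s, 2s+1). *)
Definition form_alt (v w : V) : 'F_2 :=
  \sum_(s < r./2) (crd v s.*2 * crd w s.*2.+1 + crd v s.*2.+1 * crd w s.*2).

Definition chi_sym := chi_of_form form_sym.
Definition chi_alt := chi_of_form form_alt.

End StandardBicharacters.

(** * Tambara-Yamagami categories

   The group [A] is written additively.  A simple object is [Some a] for
   [a : A] or [None] for [m].  An object is a finite family of simple objects,
   standing for their direct sum, and a morphism is a matrix of scalars, with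
   one entry for each pair of equal simple summands. *)

Section TambaraYamagami.
Variables (R : realType) (A : finZmodType).
Variables (chi : A -> A -> R[i]) (tau : R).
Local Notation C := R[i].
Local Notation S := (option A).

Record tyOb := TyOb { ty_ix :> finType; ty_lab : ty_ix -> S }.

Definition ty_hom (X Y : tyOb) : vectType C :=
  {ffun {p : X * Y | ty_lab p.1 == ty_lab p.2} -> C^o}.

Definition ty_entry (X Y : tyOb) (f : ty_hom X Y) (i : X) (j : Y) : C :=
  if insub (i, j) is Some p then f p else 0.

Definition ty_mk (X Y : tyOb) (M : X -> Y -> C) : ty_hom X Y :=
  [ffun p => M (val p).1 (val p).2].

Definition ty_id (X : tyOb) : ty_hom X X := ty_mk (fun i j => (i == j)%:R).

Definition ty_comp (X Y Z : tyOb) (g : ty_hom Y Z) (f : ty_hom X Y) :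
    ty_hom X Z :=
  ty_mk (fun i k => \sum_(j : Y) ty_entry f i j * ty_entry g j k).

(* [ty_fuse s t u]: the simple [u] occurs (with multiplicity one) in the
   tensor product of [s] and [t]. *)
Definition ty_fuse (s t u : S) : bool :=
  match s, t, u with
  | Some a, Some b, Some c => c == a + b
  | Some _, None, None | None, Some _, None => true
  | None, None, Some _ => true
  | _, _, _ => false
  end.

(* The summand [(i, j, u)] of [X ⊗ Y] is the copy of [u] in the tensor product
   of the [i]-th summand of [X] and the [j]-th summand of [Y]. *)
Definition ty_tens (X Y : tyOb) : tyOb :=
  @TyOb {p : X * Y * S | ty_fuse (ty_lab p.1.1) (ty_lab p.1.2) p.2}
    (fun p => (val p).2).

Definition ty_tensh (X X' Y Y' : tyOb) (f : ty_hom X X') (g : ty_hom Y Y') :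
    ty_hom (ty_tens X Y) (ty_tens X' Y') :=
  ty_mk (fun p q : ty_tens _ _ =>
    let: (i, j, _) := val p in
    let: (i', j', _) := val q in
    ty_entry f i i' * ty_entry g j j').

Definition ty_simple (s : S) : tyOb := @TyOb unit (fun=> s).

Definition ty_one : tyOb := ty_simple (Some 0).

(* The entries of the associativity constraint on the summand [w] of
   [s ⊗ t ⊗ u]; [x] is the intermediate summand of [s ⊗ t] and [y] the
   intermediate summand of [t ⊗ u]. *)
Definition ty_F (s t u w x y : S) : C :=
  match s, t, u, w, x, y with
  | Some a, None, Some b, _, _, _ => chi a b
  | None, Some a, None, Some z, _, _ => chi a z
  | None, None, None, _, Some x', Some y' => tau%:C%C * (chi x' y')^-1
  | _, _, _, _, _, _ => 1
  end.

Definition ty_assoc (X Y Z : tyOb) :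
    ty_hom (ty_tens (ty_tens X Y) Z) (ty_tens X (ty_tens Y Z)) :=
  ty_mk (fun (p : ty_tens (ty_tens X Y) Z) (q : ty_tens X (ty_tens Y Z)) =>
    let: (ij, k, w) := val p in
    let: (i, j, x) := val ij in
    let: (i', jk, _) := val q in
    let: (j', k', y) := val jk in
    if [&& i == i', j == j' & k == k']
    then ty_F (ty_lab i) (ty_lab j) (ty_lab k) w x y else 0).

Definition ty_lunit (X : tyOb) : ty_hom (ty_tens ty_one X) X :=
  ty_mk (fun (p : ty_tens ty_one X) i => ((val p).1.2 == i)%:R).

Definition ty_runit (X : tyOb) : ty_hom (ty_tens X ty_one) X :=
  ty_mk (fun (p : ty_tens X ty_one) i => ((val p).1.1 == i)%:R).

Definition ty_dual (X : tyOb) : tyOb :=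
  @TyOb X (fun i => omap (@GRing.opp A) (ty_lab i)).

Definition ty_coev (X : tyOb) : ty_hom ty_one (ty_tens X (ty_dual X)) :=
  ty_mk (fun _ (p : ty_tens X (ty_dual X)) =>
    ((val p).1.1 == (val p).1.2 :> X)%:R).

Definition ty_ev (X : tyOb) : ty_hom (ty_tens (ty_dual X) X) ty_one :=
  ty_mk (fun (p : ty_tens (ty_dual X) X) _ =>
    if (val p).1.1 == (val p).1.2 :> X then
      if ty_lab (val p).1.2 is None then (tau%:C%C)^-1 else 1
    else 0).

(* The bidual of [X] has the same summands as [X], since [- - a = a]. *)
Definition ty_piv (X : tyOb) : ty_hom X (ty_dual (ty_dual X)) :=
  ty_mk (fun (i : X) (j : ty_dual (ty_dual X)) =>
    if i == j :> X then
      if ty_lab i is None then (Num.sg tau)%:C%C else 1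
    else 0).

Definition TY : pivotalData C :=
  @PivotalData C tyOb ty_hom ty_id ty_comp ty_tens ty_tensh ty_one ty_assoc
    ty_lunit ty_runit ty_dual ty_coev ty_ev ty_piv.

Definition TYm : TY := ty_simple None.

End TambaraYamagami.

(* Main.v *)
Require Import Defs.
From mathcomp Require Import all_boot all_order all_algebra.
From mathcomp Require Import boolp classical_sets reals.
From mathcomp Require Import complex.
From mathcomp Require Import ring.

(** The space [Hom(1, m^(2k))] has a basis indexed by the words
    [x_1 ... x_(k-1)] in [A]: the object [m^(2k-1)] is a sum of copies of [m],
    one for each such word, and [1] occurs once in [m ⊗ m].

    In the operator [E_m^(2k)], everything that precedes the final associativity
    isomorphism contributes only the factor [sgn(tau)]: in [dualA_mE] the entry
    [tau] of the inverse associativity cancels the [tau^-1] of the evaluation,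
    and in [dualB_mE] all entries are [0] or [1]; see [FSoperator_mE].  The
    isomorphism [m^(2k-1) ⊗ m -> m^(2k)] is built by recursion from the
    constraints [chi(a, u)] on [(m ⊗ a) ⊗ m] and [tau chi(x, y)^-1] on
    [(m ⊗ m) ⊗ m].  Its entries are therefore explicit products ([snocE]), and
    the trace is ([FSindicator_mE])
      [nu_(2k)(m) = sgn(tau) tau^(k-1)
         sum_x prod_i chi(x_i, x_i)^-1 prod_i chi(x_i, x_(i+1))],
    which is evaluated one variable at a time ([chain_sum]).

    If [chi] is alternating, the factors [chi(x_i, x_i)] disappear, and two
    summations multiply the sum by [tau^2 |A| = 1]: the result has period two in
    [k] ([chain_sum_alt]).  If [chi] is isometric to the standard symmetric
    bicharacter, the sum is the product over the [r] coordinates of the same sum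
    over [F_2] ([chain_sum_sym]).  One summation there sends the pair of values
    [(u, v)] at [0] and [1] to [(u - v, u + v)], so it multiplies [u + iv] by
    [1 + i] and [u - iv] by [1 - i] ([chain_sum2E]); hence the sum over [F_2] is
    [((1 + i)^k + (1 - i)^k) / 2 = (1 + i)^k (1 + i^-k) / 2]. *)

Import Order.TTheory GRing.Theory Num.Theory.
Local Open Scope ring_scope.

Set Implicit Arguments.
Unset Strict Implicit.

(* Iterated tensor powers are compared by unfolding the powers first: unfolding
   the tensor product first exposes large nested finite types. *)
Strategy 1000 [ty_tens ty_tensh ty_comp ty_assoc ty_id ty_simple ty_one
  ty_hom ty_dual ty_mk ty_entry].

(** * Traces and inverse morphisms *)

(** The trace of an endomorphism of a space of finite functions, read off from
    its matrix in the basis of indicator functions. *)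
Lemma lin_trace_ffun (K : fieldType) (I : finType) (M : I -> I -> K)
    (g : {ffun I -> K^o} -> {ffun I -> K^o}) :
  (forall v j, g v j = \sum_i v i * M i j) -> lin_trace g = \sum_i M i i.
Proof.
move=> gE.
rewrite /lin_trace.
set e := vbasis _.
pose d i : {ffun I -> K^o} := [ffun j => M i j].
have gd v : g v = \sum_i (v i : K) *: d i.
  apply/ffunP=> j; rewrite gE sum_ffunE.
  by apply: eq_bigr => i _; rewrite !ffunE.
under eq_bigr => j _.
  rewrite gd linear_sum /=.
  under eq_bigr => i _ do rewrite linearZ /=.
  over.
rewrite exchange_big /=; apply: eq_bigr => i _.
have -> : M i i = d i i by rewrite ffunE.
rewrite {2}(coord_vbasis (memvf (d i))) sum_ffunE.
by apply: eq_bigr => j _; rewrite !ffunE mulrC.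
Qed.

(** As the data of a pivotal category carry no coherence laws, the instances of
    associativity and of the unit laws that make an inverse unique are
    hypotheses. *)
Lemma pv_inv_unique (K : fieldType) (C : pivotalData K) (X Y : C)
    (f : pv_hom X Y) (g : pv_hom Y X) :
  pv_comp g f = pv_id X -> pv_comp f g = pv_id Y ->
  (forall g' : pv_hom Y X,
     pv_comp (pv_comp g f) g' = pv_comp g (pv_comp f g')) ->
  (forall g' : pv_hom Y X, pv_comp (pv_id X) g' = g') ->
  (pv_comp g (pv_id Y) = g) ->
  pv_inv f = g.
Proof.
move=> gf fg gfA idg gid; apply: xget_unique => // g' [_ fg'].
by rewrite -[LHS]idg -gf gfA fg' gid.
Qed.

(** * Morphisms as matrices *)

Section Entries.
Context {R : realType} {A : finZmodType}.
Local Notation C := R[i].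
Implicit Types X Y Z : tyOb A.
Local Notation hom := (@ty_hom R A).
Local Notation entry f i j := (@ty_entry R A _ _ f i j).

Lemma ty_entryE X Y (f : hom X Y) p : f p = entry f (val p).1 (val p).2.
Proof. by rewrite /ty_entry -surjective_pairing valK. Qed.

Lemma ty_entry_lab X Y (f : hom X Y) i j :
  ty_lab i != ty_lab j -> entry f i j = 0.
Proof. by move=> ne; rewrite /ty_entry insubN. Qed.

Lemma ty_entry_mk X Y (M : X -> Y -> C) i j :
  entry (ty_mk M) i j = if ty_lab i == ty_lab j then M i j else 0.
Proof.
rewrite /ty_entry; case: insubP => [p -> pE|/negPf-> //].
by rewrite ffunE pE.
Qed.

Lemma ty_homP X Y (f g : hom X Y) :
  (forall i j, entry f i j = entry g i j) -> f = g.
Proof. by move=> fg; apply/ffunP=> p; rewrite !ty_entryE fg. Qed.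

Lemma ty_entry_id X i j : entry (ty_id R X) i j = (i == j)%:R.
Proof. by rewrite ty_entry_mk; case: eqVneq => // /eqP; case: eqP => // ->. Qed.

(** No condition on the labels of [i], [j] and [k] is needed, since entries
    between summands with distinct labels vanish. *)
Lemma ty_entry_comp X Y Z (g : hom Y Z) (f : hom X Y) i k :
  entry (ty_comp g f) i k = \sum_j entry f i j * entry g j k.
Proof.
rewrite ty_entry_mk; case: eqVneq => // ne.
rewrite big1 // => j _; have [ij|ij] := eqVneq (ty_lab i) (ty_lab j).
  by rewrite [entry g _ _]ty_entry_lab ?mulr0 // -ij.
by rewrite ty_entry_lab ?mul0r.
Qed.

Lemma ty_compA X Y Z W (h : hom Z W) (g : hom Y Z) (f : hom X Y) :
  ty_comp (ty_comp h g) f = ty_comp h (ty_comp g f).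
Proof.
apply: ty_homP => i l; rewrite !ty_entry_comp.
under eq_bigr => j _ do rewrite ty_entry_comp big_distrr.
under [in RHS]eq_bigr => k _ do rewrite ty_entry_comp big_distrl.
rewrite exchange_big; apply: eq_bigr => k _; apply: eq_bigr => j _.
by rewrite /= mulrA.
Qed.

(** Summation against a Kronecker delta. *)
Lemma sum_delta_mul (I : finType) (i0 : I) (F : I -> C) :
  \sum_i (i == i0)%:R * F i = F i0.
Proof.
rewrite (bigD1 i0) //= eqxx mul1r big1 ?addr0 // => i /negPf->.
by rewrite mul0r.
Qed.

Lemma ty_comp1f X Y (f : hom X Y) : ty_comp (ty_id R Y) f = f.
Proof.
apply: ty_homP => i j; rewrite ty_entry_comp.
under eq_bigr => k _ do rewrite ty_entry_id mulrC.
exact: sum_delta_mul.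
Qed.

Lemma ty_compf1 X Y (f : hom X Y) : ty_comp f (ty_id R X) = f.
Proof.
apply: ty_homP => i j; rewrite ty_entry_comp.
under eq_bigr => k _ do rewrite ty_entry_id eq_sym.
exact: sum_delta_mul.
Qed.

End Entries.

Section Inverse.
Context {R : realType} {A : finZmodType} (chi : A -> A -> R[i]) (tau : R).
Local Notation C := R[i].
Implicit Types X Y : tyOb A.
Local Notation hom := (@ty_hom R A).
Local Notation entry f i j := (@ty_entry R A _ _ f i j).

Lemma ty_pv_inv X Y (f : hom X Y) (g : hom Y X) :
  ty_comp g f = ty_id R X -> ty_comp f g = ty_id R Y ->
  @pv_inv _ (TY chi tau) X Y f = g.
Proof.
move=> gf fg; apply: pv_inv_unique => //.
- by move=> g'; apply: ty_compA.
- by move=> g'; apply: ty_comp1f.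
- exact: ty_compf1.
Qed.

(** A multiple of a relabelling bijection of the summands is invertible, and its
    inverse is the inverse multiple of the inverse bijection. *)
Lemma ty_inv_monomial X Y (f : hom X Y) (c : C) (s : X -> Y) (s' : Y -> X) :
  cancel s s' -> cancel s' s -> c != 0 ->
  (forall i j, entry f i j = c * (j == s i)%:R) ->
  forall j i,
  entry (@pv_inv _ (TY chi tau) X Y f : hom Y X) j i = c^-1 * (i == s' j)%:R.
Proof.
move=> sK s'K c0 fE.
have labs i : ty_lab i = ty_lab (s i).
  apply: contra_neq_eq c0 => ne.
  by have := fE i (s i); rewrite ty_entry_lab // eqxx mulr1.
have labs' j : ty_lab j = ty_lab (s' j) by rewrite labs s'K.
pose g : hom Y X := ty_mk (fun j i => c^-1 * (i == s' j)%:R).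
have gE j i : entry g j i = c^-1 * (i == s' j)%:R.
  rewrite ty_entry_mk; case: (eqVneq i) => [->|]; first by rewrite -labs' eqxx.
  by rewrite mulr0 if_same.
suff -> : @pv_inv _ (TY chi tau) X Y f = g by [].
apply: ty_pv_inv; apply: ty_homP => i k; rewrite ty_entry_comp ty_entry_id.
  under eq_bigr => j _ do rewrite fE gE [c * _]mulrC -mulrA mulVKf //.
  by rewrite sum_delta_mul sK eq_sym.
under eq_bigr => j _ do rewrite fE gE [_ * _%:R]mulrC -mulrA mulKf //.
by rewrite sum_delta_mul s'K eq_sym.
Qed.

End Inverse.

(** * Orthogonality relations *)

Lemma bichar0l (R : realType) (A : finZmodType) (chi : A -> A -> R[i]) a :
  bicharacter chi -> chi 0 a = 1.
Proof.
case=> nz cD _; apply: (mulIf (nz 0 a)).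
by rewrite -cD addr0 mul1r.
Qed.

Section Computation.
Context {R : realType} {A : finZmodType} (chi : A -> A -> R[i]) (tau : R).
Local Notation C := R[i].
Local Notation hom := (@ty_hom R A).
Local Notation entry f i j := (@ty_entry R A _ _ f i j).
Hypotheses (hchi : bicharacter chi) (hsym : symmetric_bichar chi)
  (hnd : nondegenerate_bichar chi)
  (htau : tau ^+ 2 = (#|A|%:R)^-1).
Local Notation T := (TY chi tau).
Local Notation m := (ty_simple (None : option A)).
Local Notation one := (ty_one A).

Lemma bichar_neq0 a b : chi a b != 0. Proof. by case: hchi. Qed.

Lemma bicharDl a b c : chi (a + b) c = chi a c * chi b c.
Proof. by case: hchi. Qed.

Lemma bicharNl a b : chi (- a) b = (chi a b)^-1.
Proof.
apply: (mulIf (bichar_neq0 a b)).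
by rewrite -bicharDl addNr (bichar0l _ hchi) mulVf ?bichar_neq0.
Qed.

Lemma natr_card_neq0 : #|A|%:R != 0 :> C.
Proof. by rewrite pnatr_eq0 -lt0n; apply/card_gt0P; exists 0. Qed.

(** A non-trivial character of [A] sums to zero: multiplication by a value
    different from [1] permutes the terms. *)
Lemma sum_bichar a : \sum_x chi a x = if a == 0 then #|A|%:R else 0.
Proof.
case: eqVneq => [->|a0].
  under eq_bigr => x _ do rewrite (bichar0l _ hchi).
  by rewrite sumr_const.
have [x ax] : exists x, chi a x != 1.
  apply: contrapT => no; move/eqP: a0; apply; apply: hnd => x.
  rewrite hsym; apply/eqP; apply: contrapT => ax; apply: no.
  by exists x; apply/negP.
have : (chi a x - 1) * \sum_y chi a y = 0.
  rewrite mulrBl mul1r big_distrr /=.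
  rewrite [X in _ - X](reindex_inj (addrI x)) /=.
  rewrite -sumrB big1 // => y _.
  by case: hchi => _ _ ->; rewrite subrr.
by move/eqP; rewrite mulf_eq0 subr_eq0 (negPf ax) => /eqP.
Qed.

Lemma tau_sqr : tau%:C%C * tau%:C%C = (#|A|%:R)^-1 :> C.
Proof.
have -> : (#|A|%:R : C) = ((#|A|%:R : R)%:C)%C by rewrite rmorph_nat.
by rewrite -rmorphM -expr2 htau fmorphV.
Qed.

Lemma tau_neq0 : tau%:C%C != 0 :> C.
Proof.
apply/eqP => t0; have := tau_sqr; rewrite t0 mul0r => /eqP.
by rewrite eq_sym invr_eq0 (negPf natr_card_neq0).
Qed.

(** The matrix of the associativity constraint on [(m ⊗ m) ⊗ m] is inverted by
    the transpose of [tau chi]. *)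
Lemma bichar_orth x x' :
  \sum_y (tau%:C%C * (chi x y)^-1) * (tau%:C%C * chi x' y) = (x == x')%:R.
Proof.
under eq_bigr => y _ do rewrite mulrACA tau_sqr -bicharNl -bicharDl.
rewrite -big_distrr sum_bichar /= addrC subr_eq0 eq_sym.
by case: eqP => _; rewrite ?mulr0 // mulVf // natr_card_neq0.
Qed.

(** * The duality isomorphisms on multiples of m

    The index types of tensor products are subtypes of triples, so the summands
    of each small product have to be named. *)

(** The summand [x] of [m ⊗ m]. *)
Definition mm_ix (x : A) : ty_tens m m :=
  @exist (unit * unit * option A)
    (fun p => ty_fuse None None p.2) (tt, tt, Some x) isT.

(** The unique summand of [1 ⊗ 1]; its label is literally [0 + 0]. *)
Definition one_one_ix : ty_tens one one :=
  @exist (unit * unit * option A)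
    (fun p => ty_fuse (Some 0) (Some 0) p.2) (tt, tt, Some (0 + 0)) (eqxx _).

Lemma one_one_ixP (p : ty_tens one one) : p = one_one_ix.
Proof.
case: p => [[[[] []] [w|]] //= hw]; apply: val_inj => /=.
by move: hw => /eqP ->.
Qed.

(** The unique summand of [1 ⊗ m]. *)
Definition one_m_ix : ty_tens one m :=
  @exist (unit * unit * option A) (fun p => ty_fuse (Some 0) None p.2)
    (tt, tt, None) isT.

(** The summand [x] of [(1 ⊗ m) ⊗ m]. *)
Definition one_m_m_ix (x : A) : ty_tens (ty_tens one m) m :=
  @exist (ty_tens one m * unit * option A)
    (fun p => ty_fuse (ty_lab p.1.1) None p.2) (one_m_ix, tt, Some x) isT.

Lemma one_mm_fuse x : ty_fuse (Some 0) (Some x : option A) (Some x).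
Proof. by rewrite /= add0r. Qed.

(** The summand [x] of [1 ⊗ (m ⊗ m)]. *)
Definition one_mm_ix (x : A) : ty_tens one (ty_tens m m) :=
  exist _ (tt, mm_ix x, Some x) (one_mm_fuse x).

Lemma one_m_m_ixE p : p = one_m_m_ix (odflt 0 (val p).2).
Proof.
case: p => [[[[[[[] []] [x|]] //= hx] []] [w|]] //= hw]; apply: val_inj => /=.
by congr (_, _, _); apply: val_inj.
Qed.

Lemma one_mm_ixE q : q = one_mm_ix (odflt 0 (val q).2).
Proof.
case: q => [[[[] [[[[] []] [x|]] //= hx]] [w|]] //= hw]; apply: val_inj => /=.
move: hw => /= /eqP ->; rewrite add0r.
by congr (_, _, _); apply: val_inj.
Qed.

(** The unique summand of [m ⊗ 1]. *)
Definition m_one_ix : ty_tens m one :=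
  @exist (unit * unit * option A) (fun p => ty_fuse None (Some 0) p.2)
    (tt, tt, None) isT.

Lemma m_one_ixP (p : ty_tens m one) : p = m_one_ix.
Proof. by case: p => [[[[] []] [w|]] //= hw]; apply: val_inj. Qed.

Lemma one_m_ixP (p : ty_tens one m) : p = one_m_ix.
Proof. by case: p => [[[[] []] [w|]] //= hw]; apply: val_inj. Qed.

Lemma sgr_tau_neq0 : (Num.sg tau)%:C%C != 0 :> C.
Proof.
have : tau != 0 by apply: contra_neq tau_neq0 => ->.
by rewrite -sgr_eq0; apply: contra_neq => /(congr1 (@complex.Re R)).
Qed.

Lemma piv_mVE i j :
  entry (@pv_inv _ T m m (ty_piv tau m : hom m m) : hom m m) i j =
  (Num.sg tau)%:C%C.
Proof.
rewrite (@ty_inv_monomial R A chi tau m m (ty_piv tau m)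
  (Num.sg tau)%:C%C id id) //.
- case: i j => [] []; rewrite eqxx mulr1 -fmorphV; congr (_%:C)%C.
  by case: sgrP; rewrite ?invr0 ?invrN ?invr1.
- exact: sgr_tau_neq0.
- by move=> [] []; rewrite ty_entry_mk /= mulr1.
Qed.

(* Here [Z] is a direct sum of copies of [m]. *)
Section MultipleOfM.
Variables (Z : tyOb A) (hZ : forall z : Z, ty_lab z = None).

Lemma mm_Z_fuse x z : ty_fuse (Some x) (ty_lab (t:=Z) z) None.
Proof. by rewrite hZ. Qed.

Lemma m_Z_fuse y z : ty_fuse None (ty_lab (t:=Z) z) (Some y : option A).
Proof. by rewrite hZ. Qed.

(** The summand of [(m ⊗ m) ⊗ Z] given by the intermediate summand [p.1] of
    [m ⊗ m] and the summand [p.2] of [Z]. *)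
Definition mm_Z_ix (p : A * Z) : ty_tens (ty_tens m m) Z :=
  exist _ (mm_ix p.1, p.2, None) (mm_Z_fuse p.1 p.2).

(** The copy of [y] in [m ⊗ z], for a summand [z] of [Z]. *)
Definition mZ_ix (y : A) (z : Z) : ty_tens m Z :=
  exist _ (tt, z, Some y) (m_Z_fuse y z).

(** The summand of [m ⊗ (m ⊗ Z)] given by the intermediate summand [p.1] of
    [m ⊗ p.2]. *)
Definition m_mZ_ix (p : A * Z) : ty_tens m (ty_tens m Z) :=
  exist _ (tt, mZ_ix p.1 p.2, None) isT.

Lemma mm_Z_ix_bij : bijective mm_Z_ix.
Proof.
exists (fun q : ty_tens (ty_tens m m) Z =>
  (odflt 0 (val (val q).1.1).2, (val q).1.2)) => [[x z]//|].
move=> [[[[[[[] []] [x|]] //= hx] z] w] /= hw]; apply: val_inj => /=.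
case: w hw; rewrite ?hZ // => _.
by congr (_, _, _); apply: val_inj.
Qed.

Lemma m_mZ_ix_bij : bijective m_mZ_ix.
Proof.
exists (fun q : ty_tens m (ty_tens m Z) =>
  (odflt 0 (val (val q).1.2).2, (val (val q).1.2).1.2)) => [[x z]//|].
move=> [[[[] [[[[] z] [x|]] /= hx]] w] /= hw]; apply: val_inj => /=; last first.
  by exfalso; move: hx; rewrite hZ.
case: w hw => // _.
by congr (_, _, _); apply: val_inj.
Qed.

Lemma mm_assocE p q :
  entry (ty_assoc chi tau m m Z) (mm_Z_ix p) (m_mZ_ix q) =
  tau%:C%C * (chi p.1 q.1)^-1 * (p.2 == q.2)%:R.
Proof. by rewrite ty_entry_mk /= hZ /=; case: eqP; rewrite ?mulr1 ?mulr0. Qed.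

(** The inverse of the associativity constraint for [m], [m] and [Z].  The
    intermediate summands of [m ⊗ m] and [m ⊗ Z] always lie in [A], so the
    default value [0] is never used. *)
Definition mm_unassoc :
    hom (ty_tens m (ty_tens m Z)) (ty_tens (ty_tens m m) Z) :=
  ty_mk (fun (q : ty_tens m (ty_tens m Z)) (p : ty_tens (ty_tens m m) Z) =>
    tau%:C%C * chi (odflt 0 (val (val p).1.1).2) (odflt 0 (val (val q).1.2).2)
    * ((val p).1.2 == (val (val q).1.2).1.2)%:R).

Lemma mm_unassocE p q :
  entry mm_unassoc (m_mZ_ix q) (mm_Z_ix p) =
  tau%:C%C * chi p.1 q.1 * (p.2 == q.2)%:R.
Proof. by rewrite ty_entry_mk. Qed.

Lemma mm_assocV :
  @pv_inv _ T (ty_tens (ty_tens m m) Z) _ (ty_assoc chi tau m m Z) = mm_unassoc.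
Proof.
have [l' lK l'K] := mm_Z_ix_bij; have [r' rK r'K] := m_mZ_ix_bij.
apply: ty_pv_inv; apply: ty_homP => p q; rewrite ty_entry_comp ty_entry_id.
  rewrite -(l'K p) -(l'K q); case: (l' p) (l' q) => x z [x' z'] {p q l' lK l'K}.
  rewrite (reindex m_mZ_ix) /=; last exact: onW_bij m_mZ_ix_bij.
  rewrite (bij_eq mm_Z_ix_bij) xpair_eqE.
  under eq_bigr => i _ do rewrite mm_assocE mm_unassocE mulrACA.
  rewrite -(pair_bigA _ (fun y z'' =>
    tau%:C%C * (chi x y)^-1 * (tau%:C%C * chi x' y)
    * ((z == z'')%:R * (z' == z'')%:R))) /=.
  under eq_bigr => y _.
    rewrite -big_distrr /=.
    under eq_bigr => z'' _ do rewrite eq_sym.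
    rewrite sum_delta_mul; over.
  by rewrite -big_distrl /= bichar_orth [z' == z]eq_sym -natrM mulnb.
rewrite -(r'K p) -(r'K q); case: (r' p) (r' q) => y z [y' z'] {p q r' rK r'K}.
rewrite (reindex mm_Z_ix) /=; last exact: onW_bij mm_Z_ix_bij.
rewrite (bij_eq m_mZ_ix_bij) xpair_eqE.
under eq_bigr => i _ do rewrite mm_assocE mm_unassocE mulrACA.
rewrite -(pair_bigA _ (fun x z'' =>
  tau%:C%C * chi x y * (tau%:C%C * (chi x y')^-1)
  * ((z'' == z)%:R * (z'' == z')%:R))) /=.
under eq_bigr => x _.
  rewrite -big_distrr /= sum_delta_mul mulrC [_ * (_ * _^-1)]mulrC.
  rewrite [chi x y]hsym [chi x y']hsym; over.
by rewrite -big_distrr /= bichar_orth -natrM mulnb andbC [y' == y]eq_sym.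
Qed.

Lemma one_Z_fuse z : ty_fuse (Some 0) (ty_lab (t:=Z) z) (None : option A).
Proof. by rewrite hZ. Qed.

(** The summand of [1 ⊗ Z] given by a summand of [Z]. *)
Definition one_Z_ix (z : Z) : ty_tens one Z :=
  exist _ (tt, z, None) (one_Z_fuse z).

Lemma lunit_mE r z : entry (ty_lunit R Z) r z = (r == one_Z_ix z)%:R.
Proof.
have rN : ty_lab r = None.
  by case: r => [[[[] z'] w] /= hw]; move: hw; rewrite hZ; case: w.
rewrite ty_entry_mk hZ rN eqxx; congr (nat_of_bool _)%:R.
case: r rN => [[[[] z'] w] /= hw] wN.
apply/eqP/eqP => [zE|/(congr1 val) [] //].
by apply: val_inj; rewrite /= zE wN.
Qed.

Lemma ev_mE p z :
  entry (ty_comp (ty_lunit R Z) (ty_tensh (ty_ev tau m) (ty_id R Z)))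
    (mm_Z_ix p) z
  = (tau%:C%C)^-1 * ((p.1 == 0)%:R * (p.2 == z)%:R).
Proof.
rewrite ty_entry_comp.
under eq_bigr => r _ do rewrite lunit_mE mulrC.
rewrite sum_delta_mul ty_entry_mk /= ty_entry_id ty_entry_mk /= mulrA.
have -> : (Some p.1 == Some (0 : A)) = (p.1 == 0) by [].
by case: (p.1 == 0); rewrite ?mulr1 ?mulr0.
Qed.

(** Only the entries of the inverse associativity with first index [0] meet the
    evaluation; they equal [tau], which cancels the factor [tau^-1]. *)
Lemma ev_unassocE q z :
  entry (ty_comp (ty_comp (ty_lunit R Z) (ty_tensh (ty_ev tau m) (ty_id R Z)))
     mm_unassoc) (m_mZ_ix q) z = (q.2 == z)%:R.
Proof.
rewrite ty_entry_comp (reindex mm_Z_ix) /=; last exact: onW_bij mm_Z_ix_bij.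
rewrite (bigD1 (0, q.2)) //= big1 => [|p ne].
  rewrite mm_unassocE ev_mE /= !eqxx (bichar0l _ hchi) addr0 !mulr1 mul1r.
  by rewrite mulVKf ?tau_neq0.
rewrite mm_unassocE ev_mE; case: eqP => [e2|]; last by rewrite mulr0 mul0r.
case: eqP => [e1|]; last by rewrite mul0r !mulr0.
by case/eqP: ne; rewrite [p]surjective_pairing e1 e2.
Qed.

(** The duality isomorphism [A] merely forgets the first factor [m]. *)
Lemma dualA_mE (f : hom one (ty_tens m Z)) a z :
  entry (@dualA _ T one m Z f : hom (ty_tens m one) Z) a z =
  entry f tt (mZ_ix 0 z).
Proof.
rewrite /dualA /=.
(* The objects [m^*] and [m] are convertible. *)
have -> : @pv_inv _ T (ty_tens (ty_tens m m) Z) (ty_tens m (ty_tens m Z))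
   (ty_assoc chi tau (ty_dual m) m Z) = mm_unassoc by exact: mm_assocV.
rewrite ty_entry_comp (reindex m_mZ_ix) /=; last exact: onW_bij (m_mZ_ix_bij).
have idfE q :
    entry (ty_tensh (ty_id R m : hom (ty_dual m) (ty_dual m)) f) a (m_mZ_ix q) =
    (q.1 == 0)%:R * entry f tt (mZ_ix 0 q.2).
  rewrite ty_entry_mk /=.
  case: a => [[[[] []] [b|]]] //= _.
  rewrite ty_entry_id eqxx mul1r.
  case: eqVneq => [->|y0]; rewrite ?mul1r // mul0r.
  by rewrite ty_entry_lab //= eq_sym; apply: contra_neq y0 => -[].
under eq_bigr => q _ do rewrite idfE (ev_unassocE q z).
rewrite (bigD1 (0, z)) //= !eqxx mul1r mulr1 big1 ?addr0 // => q ne.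
case: eqP => [e1|]; last by rewrite !mul0r.
case: eqP => [e2|]; last by rewrite mulr0.
by case/eqP: ne; rewrite [q]surjective_pairing e1 e2.
Qed.

(** The duality isomorphism [B] moves a morphism whose entries [c z] depend on
    the target alone to the summands [1] of [Z ⊗ m]. *)
Lemma dualB_mE (g : hom (ty_tens one m) Z) (q : ty_tens Z m) c :
  (forall b z, entry g b z = c z) ->
  entry (@dualB _ T one m Z g : hom one (ty_tens Z m)) tt q =
  ((val q).2 == Some 0)%:R * c (val q).1.1.
Proof.
move=> gE; rewrite /dualB.
pose runitV : hom one (ty_tens one one) :=
  @pv_inv _ T (ty_tens one one) one (ty_runit R one).
pose assocV : hom (ty_tens one (ty_tens m m)) (ty_tens (ty_tens one m) m) :=
  @pv_inv _ T (ty_tens (ty_tens one m) m) (ty_tens one (ty_tens m m))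
    (ty_assoc chi tau one m m).
change (entry (ty_comp (ty_comp (ty_comp (ty_tensh g (ty_id R m)) assocV)
  (ty_tensh (ty_id R one) (ty_coev R m : hom one (ty_tens m m)))) runitV) tt q =
  ((val q).2 == Some 0)%:R * c (val q).1.1).
have runitVE j : entry runitV tt j = (j == one_one_ix)%:R.
  rewrite (@ty_inv_monomial R A chi tau _ _ (ty_runit R one) 1
    (fun=> tt) (fun=> one_one_ix)).
  - by rewrite invr1 mul1r.
  - by move=> i; exact: esym (one_one_ixP i).
  - by case.
  - exact: oner_neq0.
  - by move=> p []; rewrite [p]one_one_ixP ty_entry_mk /= addr0 eqxx mul1r.
have assocVE q' p :
    entry assocV q' p = (p == one_m_m_ix (odflt 0 (val q').2))%:R.
  rewrite (@ty_inv_monomial R A chi tau _ _ (ty_assoc chi tau one m m) 1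
    (fun p => one_mm_ix (odflt 0 (val p).2))
    (fun q => one_m_m_ix (odflt 0 (val q).2))).
  - by rewrite invr1 mul1r.
  - by move=> i; exact: esym (one_m_m_ixE i).
  - by move=> i; exact: esym (one_mm_ixE i).
  - exact: oner_neq0.
  - move=> p' q''; rewrite [p']one_m_m_ixE [q'']one_mm_ixE ty_entry_mk /= mul1r.
    case: eqVneq => [[->]|ne]; first by rewrite eqxx.
    case: eqP => // e'.
    have /= e := congr1 (fun q : ty_tens one (ty_tens m m) => (val q).2) e'.
    by rewrite e eqxx in ne.
rewrite ty_entry_comp.
under eq_bigr => j _ do rewrite runitVE.
rewrite sum_delta_mul ty_entry_comp.
(* The coevaluation of [m] is the inclusion of the summand [0] of [m ⊗ m]. *)
have coevE q' :
    entry (ty_tensh (ty_id R one) (ty_coev R m)) one_one_ix q' =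
    (q' == one_mm_ix 0)%:R.
  rewrite [q']one_mm_ixE; move: (odflt 0 _) => x; rewrite ty_entry_mk /= !addr0.
  rewrite ty_entry_id eqxx mul1r ty_entry_mk /=.
  rewrite ![Some 0 == _]eq_sym.
  case: eqVneq => [[->]|ne]; first by rewrite !eqxx.
  case: eqP => // e'.
  have /= e := congr1 (fun q : ty_tens one (ty_tens m m) => (val q).2) e'.
  by rewrite e eqxx in ne.
under eq_bigr => j _ do rewrite coevE.
rewrite sum_delta_mul ty_entry_comp.
under eq_bigr => j _ do rewrite assocVE.
rewrite sum_delta_mul ty_entry_mk /=.
case: q => [[[z []] w] /= hw]; rewrite gE ty_entry_id eqxx mulr1 eq_sym.
by case: eqP => _; rewrite ?mul1r ?mul0r.
Qed.

End MultipleOfM.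

(** The unit constraints between [dualA] and [dualB] do not change the entries. *)
Lemma units_mE Z (g : hom (ty_tens m one) Z) b z :
  entry (ty_comp (ty_comp g (@pv_inv _ T (ty_tens m one) m (ty_runit R m)))
           (ty_lunit R m)) b z = entry g m_one_ix z.
Proof.
have runitVE j :
    entry (@pv_inv _ T (ty_tens m one) m (ty_runit R m)
             : hom m (ty_tens m one)) tt j = (j == m_one_ix)%:R.
  rewrite (@ty_inv_monomial R A chi tau _ _ (ty_runit R m) 1
    (fun=> tt) (fun=> m_one_ix)).
  - by rewrite invr1 mul1r.
  - by move=> p; exact: esym (m_one_ixP p).
  - by case.
  - exact: oner_neq0.
  - by move=> p []; rewrite [p]m_one_ixP ty_entry_mk /= mul1r.
rewrite ty_entry_comp (bigD1 tt) //= big1 => [|[] //]; rewrite addr0.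
rewrite [b]one_m_ixP ty_entry_mk /= mul1r ty_entry_comp.
under eq_bigr => j _ do rewrite runitVE.
exact: sum_delta_mul.
Qed.

(** * The associativity isomorphism of tensor powers of m *)

(** The tensor power [m^n]. *)
Definition mpow (n : nat) : tyOb A := @pv_pow _ T (TYm chi tau) n.
Arguments mpow : simpl never.

(** The canonical isomorphism from [m^n ⊗ m] to [m^(n+1)]. *)
Definition snoc (n : nat) : hom (ty_tens (mpow n) m) (mpow n.+1) :=
  @pow_snoc _ T (TYm chi tau) n.

(** The operator [E_m^(n+2)] when [m^(n+1)] is a multiple of [m], that is, for
    even [n]: up to the sign of [tau], it sends the summand [1] of [m ⊗ z] to the
    image under [snoc] of the summand [1] of [z ⊗ m]. *)
Lemma FSoperator_mE n (hZ : forall z : mpow n.+1, ty_lab z = None)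
   (f : hom one (mpow n.+2)) q :
  entry (@FSoperator _ T (TYm chi tau) n.+1 f : hom one (mpow n.+2)) tt q =
  \sum_(p : ty_tens (mpow n.+1) m)
    ((val p).2 == Some 0)%:R * entry f tt (mZ_ix hZ 0 (val p).1.1) *
    ((Num.sg tau)%:C%C * entry (snoc n.+1) p q).
Proof.
rewrite /FSoperator.
have idf : @pv_comp _ T _ _ _ (@pow_uncons _ T (TYm chi tau) n.+1) f = f.
  exact: (@ty_comp1f R A _ _ f).
set g := dualA _; set h := dualB _.
have hE q' := @dualB_mE (mpow n.+1)
  (ty_comp (ty_comp g (@pv_inv _ T (ty_tens m one) m (ty_runit R m)))
     (ty_lunit R m)) q' (fun z => entry f tt (mZ_ix hZ 0 z)).
change (entry (ty_comp (ty_comp (snoc n.+1) (ty_tensh (ty_id R (mpow n.+1))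
  (@pv_inv _ T m m (ty_piv tau m : hom m m)))) h) tt q =
  \sum_(p : ty_tens (mpow n.+1) m)
    ((val p).2 == Some 0)%:R * entry f tt (mZ_ix hZ 0 (val p).1.1) *
    ((Num.sg tau)%:C%C * entry (snoc n.+1) p q)).
rewrite ty_entry_comp; apply: eq_bigr => p _; congr (_ * _).
  apply: hE => b z; rewrite units_mE.
  by rewrite /g (@dualA_mE (mpow n.+1)) idf.
rewrite ty_entry_comp.
have pivE j : entry (ty_tensh (ty_id R (mpow n.+1))
    (@pv_inv _ T m m (ty_piv tau m : hom m m))) p j =
  (j == p)%:R * (Num.sg tau)%:C%C.
  rewrite ty_entry_mk.
  have -> : (j == p) = (ty_lab p == ty_lab j) && ((val p).1.1 == (val j).1.1).
    apply/eqP/andP => [->|[]] //.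
    case: p j => [[[z []] w] /= hw] [[[z' []] w'] /= hw'] /eqP ww /eqP zz.
    by apply: val_inj; rewrite /= ww zz.
  case: p j => [[[z []] w] /= hw] [[[z' []] w'] /= hw'].
  by rewrite piv_mVE ty_entry_id; case: eqP; rewrite ?mul0r.
under eq_bigr => j _ do rewrite pivE -mulrA.
exact: sum_delta_mul.
Qed.

(** The word of a summand of [m^n]: the labels of the chosen summands of
    the successive powers [m^n], [m^(n-1)], ..., in this order, where the labels
    equal to [m] are skipped. *)
Fixpoint word (n : nat) : mpow n -> seq A :=
  match n return mpow n -> seq A with
  | 0 => fun=> [::]
  | n'.+1 =>
    (if n' is n''.+1 as n0 return (mpow n0 -> seq A) -> mpow n0.+1 -> seq A
     then fun wd (p : ty_tens m (mpow n''.+1)) =>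
       (if (val p).2 is Some a then [:: a] else [::]) ++ wd (val p).1.2
     else fun _ _ => [::]) (@word n')
  end.

Arguments word : simpl never.

Lemma wordS n (p : ty_tens m (mpow n.+1)) :
  word (p : mpow n.+2) =
  (if (val p).2 is Some a then [:: a] else [::]) ++ word (val p).1.2.
Proof. by []. Qed.

(** The label [l] of a summand of [m^n] with word [w]: it is the head of [w] if
    [b] is true, and [m] otherwise.  The first case is that of even [n]. *)
Definition head_label (b : bool) (w : seq A) (l : option A) :=
  if b then exists a s, w = a :: s /\ l = Some a else l = None.

Lemma mpow_label n (z : mpow n.+1) :
  head_label (odd n) (word z) (ty_lab z).
Proof.
rewrite /head_label.
elim: n z => [[] //|n IH] z.
have := wordS z; case: z => [[[[] z'] u] /= hu] ->.
have := IH z'; case: (odd n) => /= [[a [s [_ lz]]]|lz].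
  by move: hu; rewrite lz; case: u.
by move: hu; rewrite lz; case: u => // a _; exists a, (word (z' : mpow n.+1)).
Qed.

(** The statement of [mpow_label] for a summand displayed as one of
    [m ⊗ m^(n+1)], with its word unfolded. *)
Lemma mpow_labelS n (z : ty_tens m (mpow n.+1)) :
  head_label (~~ odd n)
    ((if ty_lab z is Some a then [:: a] else [::]) ++ word (val z).1.2)
    (ty_lab z).
Proof. exact: (@mpow_label n.+1 z). Qed.

(** The factor [chi(x, y)] that links the head [x] of a word to the next outer
    letter [y]; it is [1] for the empty word. *)
Definition link (s : seq A) (y : A) : C := if s is x :: _ then chi x y else 1.

(** The entry of [snoc] for an even power, between summands with words [xs] and
    [ys] of the same length [j]:
    [tau^j prod_i chi(x_i, y_i)^-1 prod_i chi(x_(i+1), y_i)]. *)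
Fixpoint snoc_coef (xs ys : seq A) : C :=
  if xs is x :: xs' then
    tau%:C%C * (chi x (head 0 ys))^-1 *
      (link xs' (head 0 ys) * snoc_coef xs' (behead ys))
  else 1.

Lemma snoc_fuse n (z : mpow n.+1) (q : mpow n.+2) :
  ty_fuse (ty_lab z) None (ty_lab q).
Proof.
have := mpow_label q; have := mpow_label z; rewrite /head_label [odd n.+1]/=.
case: (odd n); rewrite [~~ _]/=.
  by case=> a [s [_ zl]] ql; rewrite zl ql.
by move=> zl [a [s [_ ql]]]; rewrite zl ql.
Qed.

(** The summand of [z ⊗ m] that has the label of [q]; the entry of [snoc]
    at [q] is zero for the others. *)
Definition snoc_ix n (z : mpow n.+1) (q : mpow n.+2) : ty_tens (mpow n.+1) m :=
  exist _ (z, tt, ty_lab q) (snoc_fuse z q).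

(** One step of the recursion that defines [snoc].  The sum over the summands of
    [m ⊗ (Y ⊗ m)] reduces to one term, because the summand of [Y] and both labels
    are determined by [p] and [q]. *)
Lemma snoc_stepE (Y Y' : tyOb A) (S : hom (ty_tens Y m) Y')
    (fuseP : forall (z : Y) (q : Y'), ty_fuse (ty_lab z) None (ty_lab q))
    (p : ty_tens (ty_tens m Y) m) (q : ty_tens m Y') :
  ty_lab p = ty_lab q ->
  entry (ty_comp (ty_tensh (ty_id R m) S) (ty_assoc chi tau m Y m)) p q =
  ty_F chi tau None (ty_lab (val (val p).1.1).1.2) None (ty_lab p)
    (ty_lab (val p).1.1) (ty_lab (val q).1.2) *
  entry S (exist _ ((val (val p).1.1).1.2, tt, ty_lab (val q).1.2)
     (fuseP _ _) : ty_tens Y m) (val q).1.2.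
Proof.
rewrite ty_entry_comp.
case: p => [[[[[[[] z] x] /= hx] []] w] /= hw].
case: q => [[[[] q] w'] /= hq] /= ww'; subst w'.
pose t2 : ty_tens Y m := exist _ (z, tt, ty_lab q) (fuseP z q).
pose t0 : ty_tens m (ty_tens Y m) := exist _ (tt, t2, w) hq.
rewrite (bigD1 t0) //= big1 ?addr0 => [|t tt0].
  congr (_ * _); first by rewrite ty_entry_mk /= !eqxx.
  by rewrite ty_entry_mk /= ty_entry_id !eqxx mul1r.
rewrite !ty_entry_mk.
case: t tt0 => [[[[] [[[z' []] y] /= hy]] w'] /= hw'] tt0.
case: (eqVneq w) => [ww'|]; last by rewrite mul0r.
subst w'; rewrite eqxx; case: (eqVneq z) => [zz'|]; last by rewrite mul0r.
subst z'; have [yq|yq] := eqVneq y (ty_lab q); last first.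
  by rewrite (@ty_entry_lab _ _ _ _ S) ?mulr0.
subst y; case/eqP: tt0; apply: val_inj; congr (_, _, _).
exact: val_inj.
Qed.

Lemma snocS n (z : ty_tens m (mpow n.+1)) (q : ty_tens m (mpow n.+2)) :
  entry (snoc n.+2) (@snoc_ix n.+1 z q) q =
  ty_F chi tau None (ty_lab (val z).1.2) None (ty_lab q)
    (ty_lab z) (ty_lab (val q).1.2) *
  entry (snoc n.+1) (@snoc_ix n (val z).1.2 (val q).1.2) (val q).1.2.
Proof.
exact: (@snoc_stepE (mpow n.+1) (mpow n.+2) (snoc n.+1) (@snoc_fuse n)
  (@snoc_ix n.+1 z q) q erefl).
Qed.

(** The products that define the entries of [snoc] satisfy the recursion.
    Here [lz1] and [lq1] are the labels of two summands with words [wz] and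
    [wq]; tensoring with [m] gives summands with labels [lz] and [lq], which are
    added to the words when they lie in [A]. *)
Lemma snoc_coef_step (b : bool) (wz wq : seq A) (lz lq lz1 lq1 : option A) :
  let lcons l w : seq A := (if l is Some a then [:: a] else [::]) ++ w in
  head_label b wz lz1 -> head_label (~~ b) wq lq1 ->
  head_label (~~ b) (lcons lz wz) lz -> head_label (~~ ~~ b) (lcons lq wq) lq ->
  ty_F chi tau None lz1 None lq lz lq1 *
  (if b then snoc_coef wz wq
   else link wz (head 0 wq) * snoc_coef wz (behead wq)) =
  if ~~ b then snoc_coef (lcons lz wz) (lcons lq wq)
  else link (lcons lz wz) (head 0 (lcons lq wq)) *
    snoc_coef (lcons lz wz) (behead (lcons lq wq)).
Proof.
move=> lcons; case: b; rewrite /head_label /=.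
  by move=> [a [s [-> ->]]] _ -> [c [t [_ ->]]] /=.
by move=> -> [a [s [-> ->]]] [c [t [_ ->]]] -> /=.
Qed.

(** The closed form of the entry of [snoc] at [q], for both parities of [n]. *)
Definition snoc_entry_is n (z : mpow n.+1) (q : mpow n.+2) :=
  entry (snoc n.+1) (snoc_ix z q) q =
  if odd n then snoc_coef (word z) (word q)
  else link (word z) (head 0 (word q)) * snoc_coef (word z) (behead (word q)).

Lemma snocE_step n (IH : forall z q, @snoc_entry_is n z q)
   (z : ty_tens m (mpow n.+1)) (q : ty_tens m (mpow n.+2)) :
  @snoc_entry_is n.+1 z q.
Proof.
rewrite /snoc_entry_is snocS IH (@wordS n z) (@wordS n.+1 q).
pose z1 : mpow n.+1 := (val z).1.2; pose q1 : mpow n.+2 := (val q).1.2.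
exact: (@snoc_coef_step (odd n) (word z1) (word q1) (ty_lab z) (ty_lab q)
  (ty_lab z1) (ty_lab q1) (mpow_label z1) (mpow_label q1)
  (mpow_labelS z) (@mpow_labelS n.+1 q)).
Qed.

Lemma snocE n (z : mpow n.+1) (q : mpow n.+2) : snoc_entry_is z q.
Proof.
elim: n z q => [|n IH] z q; last exact: snocE_step.
rewrite /snoc_entry_is [snoc 1]/(ty_id R (ty_tens m m)) ty_entry_id /= mulr1.
case: z q => [] [[[[] []] w'] /= hw'].
by rewrite [_ == _](_ : _ = true) //; apply/eqP/val_inj.
Qed.

(** * The trace formula *)

Section TraceM.
Variables (Z : tyOb A) (hZ : forall z : Z, ty_lab z = None).

Lemma Z_m_fuse z x : ty_fuse (ty_lab (t:=Z) z) None (Some x : option A).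
Proof. by rewrite hZ. Qed.

(** The copy of [x] in [z ⊗ m], for a summand [z] of [Z]. *)
Definition Z_m_ix (x : A) (z : Z) : ty_tens Z m :=
  exist _ (z, tt, Some x) (Z_m_fuse z x).

Lemma sum_Z_m_ix0 (G : ty_tens Z m -> C) :
  \sum_p ((val p).2 == Some 0)%:R * G p = \sum_z G (Z_m_ix 0 z).
Proof.
transitivity (\sum_(p : ty_tens Z m | (val p).2 == Some 0) G p).
  rewrite [RHS]big_mkcond; apply: eq_bigr => p _.
  by case: eqP; rewrite ?mul1r ?mul0r.
rewrite (reindex_onto (Z_m_ix 0) (fun p => (val p).1.1)) /=; last first.
  by case=> [[[z []] w] /= hw] /eqP wE; apply: val_inj; rewrite /= wE.
by apply: eq_bigl => z; rewrite !eqxx.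
Qed.

(** The summands [1] of [m ⊗ Z] form a basis of [Hom(1, m ⊗ Z)]. *)
Lemma lin_trace_mE (g : hom one (ty_tens m Z) -> hom one (ty_tens m Z))
    (M : Z -> ty_tens m Z -> C) :
  (forall f q, entry (g f) tt q = \sum_z entry f tt (mZ_ix hZ 0 z) * M z q) ->
  lin_trace g = \sum_z M z (mZ_ix hZ 0 z).
Proof.
move=> gE.
pose I := {p : one * ty_tens m Z | ty_lab p.1 == ty_lab p.2}.
pose iz (z : Z) : I := exist _ (tt, mZ_ix hZ 0 z) (eqxx _).
have izb : bijective iz.
  exists (fun i : I => (val (val i).2).1.2) => //.
  move=> [[[] [[[[] z] w] /= hw]] /= h].
  apply: val_inj; congr (_, _); apply: val_inj; rewrite /=.
  by rewrite -(eqP h).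
rewrite (@lin_trace_ffun _ I
  (fun i j => M (val (val i).2).1.2 (val j).2) g) => [|f j].
  by rewrite (reindex iz) //=; exact: onW_bij.
rewrite ty_entryE; case: j => [[[] q] /= hj]; rewrite gE.
rewrite [RHS](reindex iz) /=; last exact: onW_bij.
apply: eq_bigr => z _; congr (_ * _).
exact: (esym (@ty_entryE R A one (ty_tens m Z) f (iz z))).
Qed.

End TraceM.

(** The sum over the words [x_1 ... x_j] in [A] of
    [tau^j chi(x_1, x) prod_i chi(x_i, x_i)^-1 prod_i chi(x_(i+1), x_i)],
    computed by successive summation; it is [1] for [j = 0]. *)
Fixpoint chain_sum (j : nat) (x : A) : C :=
  if j is j'.+1 then
    \sum_a chi a x * (tau%:C%C * (chi a a)^-1 * chain_sum j' a)
  else 1.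

Lemma mpow_doubleS_lab j (z : mpow j.*2.+1) : ty_lab z = None.
Proof. by have := mpow_label z; rewrite odd_double. Qed.

Lemma sum_mpowS j (G : seq A -> C) :
  \sum_(z : mpow j.+1.*2.+1) G (word z) =
  \sum_(z : mpow j.*2.+1) \sum_a G (a :: word z).
Proof.
rewrite (reindex (m_mZ_ix (@mpow_doubleS_lab j))) /=; last first.
  exact: onW_bij (m_mZ_ix_bij _).
by rewrite exchange_big pair_bigA.
Qed.

Lemma sum_word_chain j x :
  \sum_(z : mpow j.*2.+1) link (word z) x * snoc_coef (word z) (word z) =
  chain_sum j x.
Proof.
elim: j x => [|j IH] x.
  by rewrite (bigD1 (tt : mpow 1)) //= mul1r big1 ?addr0 // => -[].
rewrite (@sum_mpowS j (fun w => link w x * snoc_coef w w)) exchange_big /=.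
by apply: eq_bigr => a _; rewrite -!big_distrr /= IH.
Qed.

(** The even Frobenius-Schur indicators of [m], for any non-degenerate symmetric
    bicharacter of a finite abelian group. *)
Lemma FSindicator_mE k :
  FSindicator (2 * k.+1) (TYm chi tau) = (Num.sg tau)%:C%C * chain_sum k 0.
Proof.
rewrite mul2n doubleS /=.
pose hZ := @mpow_doubleS_lab k.
pose M (z : mpow k.*2.+1) (q : mpow k.*2.+2) :=
  (Num.sg tau)%:C%C * entry (snoc k.*2.+1) (Z_m_ix hZ 0 z) q.
rewrite (@lin_trace_mE (mpow k.*2.+1) hZ _ M) => [|f q]; last first.
  rewrite (FSoperator_mE hZ).
  under eq_bigr => p _ do rewrite -mulrA.
  by rewrite (@sum_Z_m_ix0 _ hZ (fun p => entry f tt (mZ_ix hZ 0 (val p).1.1) *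
    ((Num.sg tau)%:C%C * entry (snoc k.*2.+1) p q))).
rewrite /M -big_distrr /= -sum_word_chain; congr (_ * _); apply: eq_bigr => z _.
have -> : Z_m_ix hZ 0 z = snoc_ix z (mZ_ix hZ 0 z) by apply: val_inj.
rewrite (snocE z) odd_double (@wordS k.*2 (mZ_ix hZ 0 z)) /=.
by case: (word z).
Qed.

End Computation.

(** * Evaluation for the standard bicharacters *)

Lemma chain_sum_alt (R : realType) (A : finZmodType) (chi : A -> A -> R[i])
    (tau : R) (hchi : bicharacter chi) (hsym : symmetric_bichar chi)
    (hnd : nondegenerate_bichar chi) (htau : tau ^+ 2 = (#|A|%:R)^-1)
    (halt : forall a, chi a a = 1) j x :
  chain_sum chi tau j x =
  if odd j then (if x == 0 then tau%:C%C * #|A|%:R else 0) else 1.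
Proof.
elim: j x => [//|j IH] x /=; case: (odd j) IH => /= IH.
  rewrite (bigD1 0) //= big1 => [|a /negPf a0]; last by rewrite IH a0 !mulr0.
  rewrite IH eqxx (bichar0l _ hchi) halt invr1 mulr1 mul1r addr0 mulrA.
  by rewrite (tau_sqr htau) mulVf ?natr_card_neq0.
under eq_bigr => a _ do rewrite IH halt invr1 !mulr1 hsym mulrC.
rewrite -big_distrr /= (sum_bichar hchi hsym hnd).
by case: eqP => _; rewrite ?mulr0.
Qed.

Section SymmetricForm.
Variable (R : realType).
Local Notation C := R[i].

(** The non-trivial character [b |-> (-1)^b] of [F_2]. *)
Definition sgn2 (b : 'F_2) : C := (-1) ^+ (b : nat).

Lemma sgn2D a b : sgn2 (a + b) = sgn2 a * sgn2 b.
Proof.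
case: a b => [[|[|//]] ha] [[|[|//]] hb];
  by rewrite /sgn2 /= ?(expr0, expr1, mulr1, mul1r, mulrNN).
Qed.

Lemma sgn2_sum (I : finType) (F : I -> 'F_2) :
  sgn2 (\sum_i F i) = \prod_i sgn2 (F i).
Proof. by elim/big_rec2: _ => [|i y b _ <-]; rewrite ?sgn2D. Qed.

(** The analogue of [chain_sum] for [F_2] with the bicharacter [(-1)^(ab)] and
    without the powers of [tau]. *)
Fixpoint chain_sum2 (j : nat) (b : 'F_2) : C :=
  if j is j'.+1 then \sum_a sgn2 (a * b) * ((sgn2 (a * a))^-1 * chain_sum2 j' a)
  else 1.

(** These combinations of the two values of [chain_sum2] are eigenvectors of the
    summation step, with eigenvalues [1 + i] and [1 - i]. *)
Lemma chain_sum2E j :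
  chain_sum2 j 0 + 'i%C * chain_sum2 j 1 = (1 + 'i%C) ^+ j.+1 /\
  chain_sum2 j 0 - 'i%C * chain_sum2 j 1 = (1 - 'i%C) ^+ j.+1.
Proof.
elim: j => [|j [IH1 IH2]]; first by rewrite /= !mulr1 !expr1.
have i2 : 'i%C * 'i%C = -1 :> C by rewrite -expr2 sqr_i.
have F2sum (F : 'F_2 -> C) : \sum_a F a = F 0 + F 1.
  by rewrite !big_ord_recl big_ord0 addr0; congr (F _ + F _); apply: val_inj.
have w0 : chain_sum2 j.+1 0 = chain_sum2 j 0 - chain_sum2 j 1.
  rewrite /= F2sum /sgn2 !(mulr0, mulr1) /= !expr1 invr1 !mul1r invrN1.
  by rewrite mulN1r.
have w1 : chain_sum2 j.+1 1 = chain_sum2 j 0 + chain_sum2 j 1.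
  rewrite /= F2sum /sgn2 !(mulr0, mul0r, mulr1) /= !expr1 invr1 !mul1r invrN1.
  by rewrite !mulN1r opprK.
rewrite w0 w1 [in RHS]exprS -IH1 [in X in _ /\ _ = X]exprS -IH2.
set u := chain_sum2 j 0; set v := chain_sum2 j 1; split.
  transitivity (u + 'i%C * (u + v) + ('i%C * 'i%C) * v); last by ring.
  by rewrite i2; ring.
transitivity (u - 'i%C * (u + v) + ('i%C * 'i%C) * v); last by ring.
by rewrite i2; ring.
Qed.

Lemma chain_sum_sym (r : nat) (chi : 'rV['F_2]_r -> 'rV['F_2]_r -> C) (tau : R)
    (f : 'rV['F_2]_r -> 'rV['F_2]_r) :
  bijective f -> (forall v w, chi_sym R (f v) (f w) = chi v w) ->
  forall j x,
  chain_sum chi tau j x = tau%:C%C ^+ j * \prod_(i < r) chain_sum2 j (f x 0 i).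
Proof.
move=> fb fchi; elim=> [|j IH] x /=; first by rewrite big1 ?mulr1.
have symE v w : chi_sym R v w = \prod_(i < r) sgn2 (v 0 i * w 0 i).
  by rewrite -sgn2_sum.
rewrite bigA_distr_bigA /=.
rewrite (reindex (fun v : 'rV['F_2]_r => [ffun i => v 0 i])) /=; last first.
  exists (fun g : {ffun 'I_r -> 'F_2} => \row_i g i) => [v _|g _].
    by apply/rowP=> i; rewrite mxE ffunE.
  by apply/ffunP=> i; rewrite ffunE mxE.
rewrite [in RHS](reindex f) /=; last exact: onW_bij.
rewrite big_distrr /=; apply: eq_bigr => a _.
rewrite IH -!fchi !symE.
under [in RHS]eq_bigr => i _ do rewrite !ffunE.
rewrite !big_split /= prodfV exprS; ring.
Qed.

End SymmetricForm.

Set Strict Implicit.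
Unset Implicit Arguments.
Theorem theorem6p3 (R : realType) (r : nat) (hr : (1 <= r)%N)
    (chi : 'rV['F_2]_r -> 'rV['F_2]_r -> R[i])
    (hchi : bicharacter chi) (hsym : symmetric_bichar chi)
    (hnd : nondegenerate_bichar chi)
    (tau : R) (htau : tau ^+ 2 = (#|{: 'rV['F_2]_r}|%:R)^-1)
    (k : nat) (hk : (1 <= k)%N) :
  (isometric_bichar chi (@chi_sym R r) ->
     FSindicator (2 * k) (TYm chi tau) =
       (Num.sg tau)%:C%C ^+ k
       * ((1 + 'i%C) / (Num.sqrt 2)%:C%C) ^+ (r * k)
       * ((1 + 'i%C ^- k) / (Num.sqrt 2)%:C%C) ^+ r)
  /\
  (~~ odd r -> isometric_bichar chi (@chi_alt R r) ->
     FSindicator (2 * k) (TYm chi tau) =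
       if odd k then (Num.sg tau)%:C%C else 2 ^+ r./2).
Proof.
case: k hk => // k _.
have cardV : #|{: 'rV['F_2]_r}| = (2 ^ r)%N.
  by rewrite card_mx card_Fp // mul1n.
rewrite (FSindicator_mE hchi hsym hnd htau).
have s2 : Num.sqrt 2 ^+ 2 = 2 :> R by rewrite sqr_sqrtr.
pose sq : R := Num.sqrt 2; pose sqc := sq%:C%C.
have s2_neq0 : Num.sqrt 2 != 0 :> R by rewrite sqrtr_eq0 -ltNge.
have sqc_neq0 : sqc != 0.
  by rewrite /sqc -(rmorph0 (real_complex R)) (inj_eq (fmorph_inj _)).
have sqcE : sqc ^+ 2 = 2 by rewrite -rmorphXn s2 rmorph_nat.
have tau_norm : `|tau| = Num.sqrt 2 ^- r.
  apply/eqP; rewrite -(eqrXn2 (n := 2)) // ?invr_ge0 ?exprn_ge0 ?sqrtr_ge0 //.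
  rewrite real_normK ?num_real // htau cardV exprVn -exprM mulnC exprM s2.
  by rewrite natrX.
have tauE : tau = Num.sg tau * Num.sqrt 2 ^- r by rewrite -tau_norm -numEsg.
split=> [[f [fb fchi]]|rE [f [_ fchi]]].
  rewrite (chain_sum_sym tau fb fchi) raddf0.
  under eq_bigr => i _ do rewrite mxE.
  rewrite prodr_const card_ord.
  (* The contribution of one coordinate. *)
  have key : sqc ^- k * chain_sum2 R k 0 =
      ((1 + 'i%C) / sqc) ^+ k.+1 * ((1 + 'i%C ^- k.+1) / sqc).
    have [w_plus w_minus] := chain_sum2E R k.
    have i_neq0 : 'i%C != 0 :> R[i].
      by rewrite -sqrf_eq0 sqr_i oppr_eq0 oner_eq0.
    (* This turns [(1 + i)^n i^-n] into [(1 - i)^n]. *)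
    have i_conj : (1 + 'i%C) / 'i%C = 1 - 'i%C :> R[i].
      apply: (mulIf i_neq0); rewrite divfK // mulrBl mul1r -expr2 sqr_i opprK.
      by rewrite addrC.
    have wE :
        (1 + 'i%C) ^+ k.+1 * (1 + 'i%C ^- k.+1) = sqc ^+ 2 * chain_sum2 R k 0.
      rewrite mulrDr mulr1 -exprVn -exprMn i_conj -w_plus -w_minus sqcE.
      by ring.
    rewrite expr_div_n mulrACA wE.
    move: (chain_sum2 R k 0) => w; rewrite [sqc ^+ k.+1]exprS; field.
    by rewrite sqc_neq0 expf_neq0.
  (* Of the [k + 1] signs of [tau], [k] come from [tau^k]. *)
  rewrite -/sq -/sqc [(r * _)%N]mulnC exprM -mulrA -exprMn -key exprMn exprS.
  have -> : tau%:C%C = (Num.sg tau)%:C%C * sqc ^- r :> R[i].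
    by rewrite {1}tauE rmorphM fmorphV rmorphXn.
  by rewrite exprMn !exprVn -!exprM [(r * k)%N]mulnC !mulrA.
have halt a : chi a a = 1.
  rewrite -fchi /chi_alt /chi_of_form /form_alt big1 // => s _.
  by rewrite [X in _ + X]mulrC addrr_pchar2 // pchar_Fp.
rewrite (chain_sum_alt hchi hsym hnd htau halt) eqxx /=.
case: (odd k) => /=; rewrite ?mulr1 //.
rewrite mulrA -rmorphM -normrEsg tau_norm cardV natrX.
have {1 2}-> : r = (2 * r./2)%N by rewrite mul2n even_halfK.
rewrite fmorphV !rmorphXn /= exprM -/sq -/sqc sqcE.
by rewrite mul2n -addnn exprD mulKf // expf_neq0 // pnatr_eq0.
Qed.
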